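(* Let $n$ and $m$ be positive integers with $m\geq n+1$. For every integer $r$ with $1\leq r\leq m-1$, the number of $(n,m)$-lattice paths $P$ with $NPL(P)=r$ equals the number of $(n,m)$-lattice paths $P=(x_1,y_1)(x_2,y_2)\cdots(x_{n+1},y_{n+1})$ with $NPL(P)=0$ and $x_{n+1}=1$; in particular it is independent of $r$.
   Context: An $(n,m)$-lattice path is a sequence $P=(x_1,y_1)(x_2,y_2)\cdots(x_{n+1},y_{n+1})$ of vectors in $\mathbb{Z}^2$ such that $1-n\leq y_i\leq 1$ for all $i$, $\sum_{i=1}^{n+1}y_i=1$, $1\leq x_i\leq m-1$ for all $i$, and $\sum_{i=1}^{n+1}x_i=m$. For such $P$, let $NP(P)=\{i\in\{1,\ldots,n+1\}\mid \sum_{j=1}^{i}y_j\leq 0\}$, and define the non-positive length $NPL(P)=\sum_{i\in NP(P)}x_i$. *)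

(* Defs.v *)
From HB Require Import structures.
From mathcomp Require Import all_boot all_order all_algebra.

Set Implicit Arguments.
Unset Strict Implicit.
Unset Printing Implicit Defensive.

Import Order.TTheory GRing.Theory Num.Theory.
Local Open Scope ring_scope.

(* Steps are indexed from 0: [tnth P i] is the step written (x_{i+1}, y_{i+1})
   on paper, so [ord_max] is the index of the last step (x_{n+1}, y_{n+1}). *)
Definition is_lattice_path (n m : nat) (P : n.+1.-tuple (int * int)) : bool :=
  [&& [forall i, 1 - n%:Z <= (tnth P i).2 <= 1],
      \sum_(i < n.+1) (tnth P i).2 == 1,
      [forall i, 1 <= (tnth P i).1 <= m%:Z - 1] &
      \sum_(i < n.+1) (tnth P i).1 == m%:Z].

Record lattice_path (n m : nat) := LatticePath {
  steps :> n.+1.-tuple (int * int);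
  stepsP : is_lattice_path m steps
}.

HB.instance Definition _ n m := [isSub for @steps n m].
HB.instance Definition _ n m := [Choice of lattice_path n m by <:].

Definition xstep n m (P : lattice_path n m) (i : 'I_n.+1) : int := (tnth P i).1.
Definition ystep n m (P : lattice_path n m) (i : 'I_n.+1) : int := (tnth P i).2.

Definition NP n m (P : lattice_path n m) : {set 'I_n.+1} :=
  [set i : 'I_n.+1 | \sum_(j < n.+1 | (j <= i)%N) ystep P j <= 0].

Definition NPL n m (P : lattice_path n m) : int := \sum_(i in NP P) xstep P i.

(* The bounds on the steps make [lattice_path n m] finite: (x, y) is recovered
   from the bounded naturals x <= m and 1 - y <= n. *)
Definition encode_path n m (P : lattice_path n m) :
    {ffun 'I_n.+1 -> 'I_m.+1 * 'I_n.+1} :=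
  [ffun i => (inord `|xstep P i|%N, inord `|1 - ystep P i|%N)].

Definition decode_path n m (f : {ffun 'I_n.+1 -> 'I_m.+1 * 'I_n.+1}) :
    option (lattice_path n m) :=
  insub [tuple ((f i).1%:Z, 1 - (f i).2%:Z) | i < n.+1].

Lemma encode_pathK n m : pcancel (@encode_path n m) (@decode_path n m).
Proof.
move=> P; rewrite /decode_path.
suff -> : [tuple (((encode_path P) i).1%:Z, 1 - ((encode_path P) i).2%:Z)
            | i < n.+1] = steps P by exact: valK.
apply: eq_from_tnth => i; rewrite tnth_mktuple ffunE /= /xstep /ystep.
have /and4P[/forallP/(_ i) + _ /forallP/(_ i) + _] := stepsP P.
case: (tnth P i) => x y /= /andP[y_ge y_le] /andP[x_ge x_le].
have x_ge0 : 0 <= x by exact: le_trans x_ge.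
have y_ge0 : 0 <= 1 - y by rewrite subr_ge0.
rewrite !inordK ?ltnS -?lez_nat ?gez0_abs ?subKr //.
  by rewrite lerBlDr addrC -lerBlDr.
by apply: le_trans x_le _; rewrite lerBlDr lerDl.
Qed.

HB.instance Definition _ n m : isCountable (lattice_path n m) :=
  PCanIsCountable (@encode_pathK n m).
HB.instance Definition _ n m : isFinite (lattice_path n m) :=
  PCanIsFinite (@encode_pathK n m).

(* Main.v *)
(* Order the positions of a path by the height reached there, later positions
   first among equal heights.  As the y-steps sum to 1, the rotation ending at
   position k has as nonpositive positions exactly those below k.  So, over the
   n+1 rotations, NPL runs through the proper partial sums of the x-steps listed
   in increasing order, the step following each partial sum being the last
   x-step of the rotation.  Undoing this reordering (a bijection, since it
   depends on the y-steps only), n+1 times the count of paths with NPL = r is the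
   count of pairs (path, j) whose first j x-steps sum to r.  The latter does not
   change from r to r + 1: move one unit across the cut at j when the next x-step
   is at least 2, and advance the cut by one step otherwise.  For r = 1 the first
   x-step must be 1, which in the original order says that NPL = 0 and the last
   x-step is 1. *)
Require Import Defs.
From HB Require Import structures.
From mathcomp Require Import all_boot all_order all_algebra.
From mathcomp Require Import perm zify.
Set Implicit Arguments.
Unset Strict Implicit.
Unset Printing Implicit Defensive.

Import Order.TTheory GRing.Theory Num.Theory.
Local Open Scope ring_scope.

(** * Ranking positions by height *)

Section Rank.

Variables (n : nat) (y : {ffun 'I_n.+1 -> int}).

Definition height (k : 'I_n.+1) : int := \sum_(j < n.+1 | (j <= k)%N) y j.

Definition below (l k : 'I_n.+1) : bool :=
  (height l < height k) || (height l == height k) && (k < l)%N.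

Lemma below_irr k : below k k = false.
Proof. by rewrite /below ltxx ltnn andbF. Qed.

Lemma below_trans : transitive below.
Proof. by move=> k l j; rewrite /below; lia. Qed.

Lemma below_total l k : l != k -> below l k || below k l.
Proof. by rewrite -(inj_eq val_inj) /below /=; lia. Qed.

Definition rank (k : 'I_n.+1) : 'I_n.+1 := inord #|[set l | below l k]|.

(** [inord] never falls back to its default here: [k] is not below itself, so the set misses a
    position and has at most [n] elements. *)
Lemma rankE k : rank k = #|[set l | below l k]| :> nat.
Proof.
rewrite inordK // -[n.+1 in X in (_ < X)%N]card_ord -cardsT; apply: proper_card.
by rewrite properT; apply/negP=> /eqP/setP/(_ k); rewrite !inE below_irr.
Qed.

Lemma rank_homo l k : below l k -> (rank l < rank k)%N.
Proof.
move=> lk; rewrite !rankE; apply/proper_card/properP; split.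
  by apply/subsetP=> j; rewrite !inE => /below_trans; apply.
by exists l; rewrite !inE ?below_irr.
Qed.

Lemma rank_ltn l k : (rank l < rank k)%N = below l k.
Proof.
apply/idP/idP=> [|/rank_homo//].
have [-> | /below_total/orP[//|/rank_homo]] := eqVneq l k.
  by rewrite ltnn.
by move=> h1 h2; have := ltn_trans h1 h2; rewrite ltnn.
Qed.

Lemma rank_inj : injective rank.
Proof.
move=> l k eq_lk; apply/eqP; apply: contraFT (ltnn (rank k)) => /below_total.
by rewrite -!rank_ltn eq_lk orbb.
Qed.

Definition rank_perm : {perm 'I_n.+1} := perm rank_inj.

Hypothesis sum_y : \sum_i y i = 1.

(** The prefix sums [s] of the periodic extension of [y] grow by 1 per period. With
    [l = i + ordS k], the sum is [height l - height k] if there is no wrap (then [k < l]), and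
    [height l + 1 - height k] after a wrap (then [l <= k]). Being nonpositive allows equal heights
    only in the first case, which is the tie rule of [below]. *)
Lemma cyclic_sum_le0 (i k : 'I_n.+1) :
  (\sum_(j < n.+1 | (j <= i)%N) y (j + ordS k) <= 0) = below (i + ordS k) k.
Proof.
pose s c : int := \sum_(0 <= j < c) y (inord (j %% n.+1)).
have heightE l : height l = s l.+1.
  rewrite /s big_mkord (big_ord_widen n.+1 (fun j => y (inord (j %% n.+1)))) //.
  by apply: eq_bigr => j _; rewrite modn_small ?inord_val.
have s_period c : s (c + n.+1)%N = s c + 1.
  rewrite addnC /s (@big_cat_nat _ _ _ n.+1) ?leq_addr //= addrC -sum_y; congr (_ + _).
    rewrite -[X in index_iota X]add0n big_addn addKn.
    by apply: eq_bigr => j _; rewrite modnDr.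
  by rewrite big_mkord; apply: eq_bigr => j _; rewrite modn_small ?inord_val.
have sumE : \sum_(j < n.+1 | (j <= i)%N) y (j + ordS k) =
    s (k.+1 + i.+1)%N - s k.+1.
  rewrite {1}/s (@big_cat_nat _ _ _ k.+1) ?leq_addr //= -/(s _) addrAC subrr add0r.
  rewrite -[X in index_iota X]add0n big_addn addKn big_mkord.
  rewrite (big_ord_widen n.+1 (fun j => y (inord ((j + k.+1) %% n.+1)))) //=.
  apply: eq_bigr => j _; congr (y _); apply: val_inj; rewrite /= inordK ?ltn_pmod //.
  by rewrite modnDmr.
have valE : (i + ordS k)%R = ((k.+1 + i) %% n.+1)%N :> nat.
  by rewrite /= modnDmr addnC.
rewrite sumE /below !heightE valE.
have [lt_n | ge_n] := ltnP (k.+1 + i) n.+1.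
  rewrite modn_small // addnS; lia.
have -> : ((k.+1 + i) %% n.+1 = k.+1 + i - n.+1)%N.
  rewrite -{1}(subnK ge_n) modnDr modn_small //.
  by have := ltn_ord i; have := ltn_ord k; lia.
have -> : (k.+1 + i.+1 = (k.+1 + i - n.+1).+1 + n.+1)%N by lia.
rewrite s_period; have := ltn_ord i; lia.
Qed.

End Rank.

Lemma card_set_sum (T : finType) (A : pred T) :
  #|[set x | A x]| = (\sum_x A x)%N.
Proof. by rewrite -sum1dep_card big_mkcond; apply: eq_bigr => x _; case: (A x). Qed.

(** * Building paths from their steps *)

Section Paths.

Variables n m : nat.
Hypothesis n_gt0 : (0 < n)%N.

Implicit Types P Q : lattice_path n m.

Lemma xstep_ge1 P i : 1 <= xstep P i.
Proof. by have /and4P[_ _ /forallP/(_ i)/andP[]] := stepsP P. Qed.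

Lemma sum_xstep P : \sum_i xstep P i = m.
Proof. by have /and4P[_ _ _ /eqP] := stepsP P. Qed.

Lemma ystep_bounds P i : 1 - n%:Z <= ystep P i <= 1.
Proof. by have /and4P[/forallP/(_ i)] := stepsP P. Qed.

Lemma sum_ystep P : \sum_i ystep P i = 1.
Proof. by have /and4P[_ /eqP] := stepsP P. Qed.

Lemma path_eq P Q : xstep P =1 xstep Q -> ystep P =1 ystep Q -> P = Q.
Proof.
move=> eq_x eq_y; apply: val_inj; apply: eq_from_tnth => i.
rewrite [LHS]surjective_pairing [RHS]surjective_pairing.
by congr (_, _); [exact: eq_x | exact: eq_y].
Qed.

(** [P] serves only as the default value, taken when [x] and [y] do not form a path. *)
Definition path_of P (x y : 'I_n.+1 -> int) : lattice_path n m :=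
  insubd P [tuple (x i, y i) | i < n.+1].

Lemma path_ofE P (x y : 'I_n.+1 -> int) :
    (forall i, 1 <= x i) -> \sum_i x i = m ->
    (forall i, 1 - n%:Z <= y i <= 1) -> \sum_i y i = 1 ->
  xstep (path_of P x y) =1 x /\ ystep (path_of P x y) =1 y.
Proof.
move=> x_ge1 sum_x y_bounds sum_y; rewrite /xstep /ystep.
suff -> : steps (path_of P x y) = [tuple (x i, y i) | i < n.+1].
  by split=> i; rewrite tnth_mktuple.
rewrite /path_of insubdK // unfold_in; apply/and4P; split.
- by apply/forallP=> i; rewrite tnth_mktuple; apply: y_bounds.
- by apply/eqP; rewrite -[RHS]sum_y; apply: eq_bigr => i _; rewrite tnth_mktuple.
(* For the upper bound [m - 1]: as [n > 0], some other position [j] exists, and its step takes at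
   least 1 from the total [m]. *)
- apply/forallP=> i; rewrite tnth_mktuple /= x_ge1 /= -sum_x (bigD1 i) //=.
  have [j ji] : exists j : 'I_n.+1, j != i.
    exists (if i == ord0 then ord_max else ord0); have [-> | ni0] := eqVneq i ord0.
      by rewrite -(inj_eq val_inj) /= -lt0n.
    by rewrite eq_sym.
  rewrite (bigD1 j) //=.
  have := x_ge1 j; have : 0 <= \sum_(k < n.+1 | (k != i) && (k != j)) x k.
    by apply: sumr_ge0 => k _; apply: le_trans (x_ge1 k).
  by move: (\sum_(k < n.+1 | _) _) => s; lia.
- by apply/eqP; rewrite -[RHS]sum_x; apply: eq_bigr => i _; rewrite tnth_mktuple.
Qed.

(** * Rotating and reordering paths *)

Definition yfun P : {ffun 'I_n.+1 -> int} := [ffun i => ystep P i].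

Lemma sum_yfun P : \sum_i yfun P i = 1.
Proof. by rewrite -(sum_ystep P); apply: eq_bigr => i _; rewrite ffunE. Qed.

Definition shift (a : 'I_n.+1) P : lattice_path n m :=
  path_of P (fun i => xstep P (i + a)) (fun i => ystep P (i + a)).

Lemma shiftE a P :
  (forall i, xstep (shift a P) i = xstep P (i + a)) /\
  (forall i, ystep (shift a P) i = ystep P (i + a)).
Proof.
apply: path_ofE => [i||i|]; rewrite ?xstep_ge1 ?ystep_bounds //.
  by rewrite -[RHS](sum_xstep P) [RHS](reindex_inj (addIr a)).
by rewrite -[RHS](sum_ystep P) [RHS](reindex_inj (addIr a)).
Qed.

Lemma shift_inj a : injective (shift a).
Proof.
move=> P Q eq_PQ; have [xP yP] := shiftE a P; have [xQ yQ] := shiftE a Q.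
by apply: path_eq => i; rewrite -(subrK a i) -?xP -?xQ -?yP -?yQ eq_PQ.
Qed.

(** The inverse permutation puts at position [j] the x-step of rank [j]. *)
Definition relabel P : lattice_path n m :=
  path_of P (fun i => xstep P ((rank_perm (yfun P))^-1%g i)) (ystep P).

Lemma relabelE P :
  (forall i, xstep (relabel P) i = xstep P ((rank_perm (yfun P))^-1%g i)) /\
  ystep (relabel P) =1 ystep P.
Proof.
apply: path_ofE => [i||i|]; rewrite ?xstep_ge1 ?ystep_bounds ?sum_ystep //.
by rewrite -[RHS](sum_xstep P) [RHS](reindex_inj (@perm_inj _ (rank_perm (yfun P))^-1)).
Qed.

Lemma relabel_inj : injective relabel.
Proof.
move=> P Q eq_PQ; have [xP yP] := relabelE P; have [xQ yQ] := relabelE Q.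
have eq_y : ystep P =1 ystep Q by move=> i; rewrite -yP -yQ eq_PQ.
have eq_yfun : yfun P = yfun Q by apply/ffunP=> i; rewrite !ffunE.
apply: path_eq => // i.
by rewrite -(permK (rank_perm (yfun P)) i) -xP eq_PQ xQ eq_yfun.
Qed.

Definition psum P (j : nat) : int := \sum_(i < n.+1 | (i < j)%N) xstep P i.

Lemma NPL_shift P k :
  NPL (shift (ordS k) P) = \sum_(l | below (yfun P) l k) xstep P l.
Proof.
have [xP yP] := shiftE (ordS k) P.
rewrite (reindex_inj (addIr (ordS k))) /NPL /NP.
apply: eq_big => [i | i _]; last exact: xP.
rewrite inE -cyclic_sum_le0 ?sum_yfun //; congr (_ <= _).
by apply: eq_bigr => j _; rewrite yP ffunE.
Qed.

Lemma ord_maxDS (k : 'I_n.+1) : ord_max + ordS k = k.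
Proof. by apply: val_inj; rewrite /= modnDmr addnS -addSn modnDl modn_small. Qed.

(** Each rotation permutes the paths, which accounts for the factor [n.+1]. For fixed [P], the
    rotation ending at [k] gives the term [j = rank k] of [relabel P]. A general [F] covers both
    counts to be compared. *)
Lemma sum_NPL (F : int -> int -> nat) :
  (n.+1 * \sum_(P : lattice_path n m) F (NPL P) (xstep P ord_max) =
   \sum_(P : lattice_path n m) \sum_(j < n.+1) F (psum P j) (xstep P j))%N.
Proof.
rewrite -[n.+1 in LHS]card_ord -sum_nat_const.
under eq_bigr => k _ do rewrite (reindex_inj (@shift_inj (ordS k))).
rewrite exchange_big [RHS](reindex_inj relabel_inj) /=; apply: eq_bigr => P _.
have [xP _] := relabelE P.
rewrite [RHS](reindex_inj (@perm_inj _ (rank_perm (yfun P)))); apply: eq_bigr => k _.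
rewrite NPL_shift (shiftE _ P).1 ord_maxDS xP permK; congr (F _ _).
rewrite /psum [RHS](reindex_inj (@perm_inj _ (rank_perm (yfun P)))) /=.
by apply: eq_big => [l | l _]; rewrite ?xP ?permK // !permE rank_ltn.
Qed.

Lemma psum0 P : psum P 0 = 0.
Proof. by apply: big1. Qed.

Lemma psumS P (k : 'I_n.+1) : psum P k.+1 = psum P k + xstep P k.
Proof.
rewrite /psum (bigD1 k) ?ltnS //= addrC; congr (_ + _); apply: eq_bigl => j.
by rewrite ltnS ltn_neqAle andbC.
Qed.

Lemma psum_full P : psum P n.+1 = m.
Proof. by rewrite -(sum_xstep P); apply: eq_bigl => j; rewrite ltn_ord. Qed.

Lemma psum_ge0 P j : 0 <= psum P j.
Proof. by apply: sumr_ge0 => k _; apply: le_trans (xstep_ge1 P k). Qed.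

(** * Moving a unit across a cut *)

Section Transfer.

Variable i : 'I_n.

Let a : 'I_n.+1 := widen_ord (leqnSn n) i.
Let b : 'I_n.+1 := lift ord0 i.

(* Moves a unit from step b to step a.  When step b is 1 this is impossible and
   the two steps are exchanged instead, which keeps the map injective. *)
Definition transfer P : lattice_path n m :=
  path_of P (fun k =>
    if k == a then if 1 < xstep P b then xstep P a + 1 else 1
    else if k == b then if 1 < xstep P b then xstep P b - 1 else xstep P a
    else xstep P k) (ystep P).

Let neq_ba : (b == a) = false.
Proof. by apply/negbTE; rewrite -(inj_eq val_inj) /= /bump leq0n add1n; lia. Qed.

Lemma transferE P :
  [/\ xstep (transfer P) a = if 1 < xstep P b then xstep P a + 1 else 1,
      xstep (transfer P) b =
        if 1 < xstep P b then xstep P b - 1 else xstep P a,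
      forall k, k != a -> k != b -> xstep (transfer P) k = xstep P k &
      ystep (transfer P) =1 ystep P].
Proof.
have xa := xstep_ge1 P a; have xb := xstep_ge1 P b.
have [k|||//|xT yT] := @path_ofE P (fun k =>
    if k == a then if 1 < xstep P b then xstep P a + 1 else 1
    else if k == b then if 1 < xstep P b then xstep P b - 1 else xstep P a
    else xstep P k) (ystep P).
- have := xstep_ge1 P k; case: ifP => _; last case: ifP => _ //; case: ifP; lia.
- rewrite -(sum_xstep P) [RHS](bigD1 a) // [LHS](bigD1 a) //= eqxx.
  rewrite [X in _ = _ + X](bigD1 b) ?neq_ba //= [X in _ + X = _](bigD1 b) ?neq_ba //=.
  rewrite eqxx !addrA; congr (_ + _); first by case: ifP; lia.
  by apply: eq_bigr => k /andP[/negbTE-> /negbTE->].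
- by move=> k; apply: ystep_bounds.
- exact: sum_ystep.
split=> //; rewrite /transfer ?xT ?eqxx ?neq_ba // => k ka kb.
by rewrite xT (negbTE ka) (negbTE kb).
Qed.

(** The image shows which case occurred: its step [a] exceeds 1 exactly when a unit was moved. *)
Lemma transfer_inj : injective transfer.
Proof.
move=> P Q eq_PQ.
have [aP bP xP yP] := transferE P; have [aQ bQ xQ yQ] := transferE Q.
have : xstep P a = xstep Q a /\ xstep P b = xstep Q b.
  move: aP bP; rewrite eq_PQ aQ bQ.
  have := xstep_ge1 P a; have := xstep_ge1 P b.
  have := xstep_ge1 Q a; have := xstep_ge1 Q b.
  by do 2!case: ifP => ?; lia.
case=> eq_a eq_b; apply: path_eq => k; last by rewrite -yP -yQ eq_PQ.
have [->//|ka] := eqVneq k a; have [->//|kb] := eqVneq k b.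
by rewrite -xP // -xQ // eq_PQ.
Qed.

Lemma transfer_psum P r :
  (psum (transfer P) i.+1 == r + 1) && (1 < xstep (transfer P) a) =
  (psum P i.+1 == r) && (1 < xstep P b).
Proof.
have [aP bP xP _] := transferE P.
rewrite !(psumS _ a) aP; have -> : psum (transfer P) a = psum P a.
  apply: eq_bigr => k lt_ka; move: lt_ka => /= lt_ka.
  by apply: xP; rewrite -(inj_eq val_inj) /= /bump ?leq0n ?add1n; lia.
have := xstep_ge1 P a; case: ifP; lia.
Qed.

End Transfer.

(** The cuts at [r] followed by a step 1 become, one place later, the cuts at [r + 1] preceded by a
    step 1; [f] counts both. The remaining cuts, next to a step of at least 2, are matched by
    [transfer]. *)
Lemma sum_psum_succ (r : int) : 1 <= r -> r + 1 <= m%:Z - 1 ->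
  (\sum_(P : lattice_path n m) \sum_(j < n.+1) (psum P j == r) =
   \sum_(P : lattice_path n m) \sum_(j < n.+1) (psum P j == (r + 1)%R))%N.
Proof.
move=> r_ge1 r_le.
pose f P (j : 'I_n.+1) : nat := (psum P j == r) && (xstep P j == 1).
pose a (i : 'I_n) := widen_ord (leqnSn n) i; pose b (i : 'I_n) := lift ord0 i.
transitivity (\sum_(P : lattice_path n m)
    ((\sum_(i < n) ((psum P i.+1 == r) && (1 < xstep P (b i))%R)) +
     \sum_(j < n.+1) f P j))%N.
  apply: eq_bigr => P _; rewrite !big_ord_recl /f psum0.
  have -> : (0 == r) = false by lia.
  rewrite !add0n -big_split; apply: eq_bigr => i _ /=.
  by have := xstep_ge1 P (b i); rewrite /b /bump leq0n add1n; lia.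
transitivity (\sum_(P : lattice_path n m)
    ((\sum_(i < n) ((psum P i.+1 == (r + 1)%R) && (1 < xstep P (a i))%R)) +
     \sum_(j < n.+1) f P j))%N; last first.
  apply: eq_bigr => P _; rewrite big_ord_recr [RHS]big_ord_recl psum0.
  have -> : (0 == r + 1) = false by lia.
  (* A final step 1 after the sum [r] would make the total [r + 1], which is less than [m]. *)
  have -> : f P ord_max = 0%N.
    by have := psum_full P; rewrite /f (psumS P ord_max) /=; lia.
  rewrite /= addn0 add0n -big_split; apply: eq_bigr => i _ /=.
  have := xstep_ge1 P (a i); rewrite /f /a /bump leq0n add1n.
  by rewrite (psumS P (widen_ord (leqnSn n) i)) /=; lia.
rewrite !big_split /=; congr (_ + _)%N.
rewrite exchange_big [RHS]exchange_big; apply: eq_bigr => i _ /=.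
rewrite [RHS](reindex_inj (@transfer_inj i)); apply: eq_bigr => P _.
by rewrite transfer_psum.
Qed.

(** As steps are at least 1, a partial sum reaches 1 only by a step 1 from 0. *)
Lemma sum_psum1 :
  (\sum_(P : lattice_path n m) \sum_(j < n.+1) (psum P j == 1%R) =
   \sum_(P : lattice_path n m)
     \sum_(j < n.+1) ((psum P j == 0%R) && (xstep P j == 1%R)))%N.
Proof.
apply: eq_bigr => P _; rewrite big_ord_recl big_ord_recr.
have -> : (psum P (@ord0 n) == 1) = false by rewrite psum0.
(* This cut comes after [n > 0] positive steps. *)
have -> : (psum P (@ord_max n) == 0) = false.
  have := psumS P (inord (n.-1)%N); rewrite inordK ?prednK //= => ->.
  by have := psum_ge0 P (n.-1)%N; have := xstep_ge1 P (inord (n.-1)%N); lia.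
rewrite /= add0n addn0; apply: eq_bigr => i _ /=.
rewrite /bump leq0n add1n (psumS P (widen_ord (leqnSn n) i)) /=.
have := xstep_ge1 P (widen_ord (leqnSn n) i); have := psum_ge0 P i; lia.
Qed.

Lemma card_NPL (k : nat) : (k.+1 < m)%N ->
  #|[set P : lattice_path n m | NPL P == k.+1]| =
  #|[set P : lattice_path n m | (NPL P == 0) && (xstep P ord_max == 1)]|.
Proof.
(* Both counts are multiplied by [n.+1] so that [sum_NPL] applies to each. *)
move=> lt_km; apply/eqP; rewrite -(eqn_pmul2l (ltn0Sn n)) !card_set_sum.
rewrite (sum_NPL (fun s _ => s == k.+1)) (sum_NPL (fun s x => (s == 0) && (x == 1))).
rewrite -sum_psum1; apply/eqP.
elim: k lt_km => // k IHk lt_km; rewrite -IHk; last by lia.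
rewrite -[k.+2]addn1 PoszD -sum_psum_succ //; lia.
Qed.

End Paths.

Theorem theorem2p7 (n m : nat) (hn : (0 < n)%N) (hm : (0 < m)%N)
    (hnm : (n + 1 <= m)%N) :
  (forall r : int, 1 <= r <= m%:Z - 1 ->
     #|[set P : lattice_path n m | NPL P == r]| =
     #|[set P : lattice_path n m | (NPL P == 0) && (xstep P ord_max == 1)]|) /\
  (forall r s : int, 1 <= r <= m%:Z - 1 -> 1 <= s <= m%:Z - 1 ->
     #|[set P : lattice_path n m | NPL P == r]| =
     #|[set P : lattice_path n m | NPL P == s]|).
Proof.
have card_r (r : int) : 1 <= r <= m%:Z - 1 ->
    #|[set P : lattice_path n m | NPL P == r]| =
    #|[set P : lattice_path n m | (NPL P == 0) && (xstep P ord_max == 1)]|.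
  by case: r => [[|k]|k] // r_bounds; apply: card_NPL => //; lia.
by split=> // r s r_bounds s_bounds; rewrite !card_r.
Qed.
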